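(* For all integers $k\ge 2$ and $t_k\ge \cdots\ge t_1\ge 3$, every $(K_{t_1},\ldots,K_{t_k})$-co-critical graph has minimum degree at least $t_k-2k-1+\sum_{i=1}^k t_i$.
   Context: All graphs are finite, simple and undirected. For graphs $G,H_1,\ldots,H_k$, write $G\rightarrow(H_1,\ldots,H_k)$ if every edge coloring $\tau:E(G)\to[k]=\{1,\ldots,k\}$ contains, for some $i\in[k]$, a copy of $H_i$ all of whose edges have color $i$. A non-complete graph $G$ is $(H_1,\ldots,H_k)$-co-critical if $G\not\rightarrow(H_1,\ldots,H_k)$ but $G+e\rightarrow(H_1,\ldots,H_k)$ for every edge $e$ of the complement $\overline{G}$, where $G+e$ denotes $G$ with the edge $e$ added. $K_t$ denotes the complete graph on $t$ vertices. *)

(* Defs.v *)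
From mathcomp Require Import all_boot.

Set Implicit Arguments.
Unset Strict Implicit.
Unset Printing Implicit Defensive.

Record sgraph := SGraph {
  vertex :> finType;
  adj : rel vertex;
  adj_sym : symmetric adj;
  adj_irrefl : irreflexive adj
}.

Definition edges (G : sgraph) : {set {set G}} :=
  [set e : {set G} | [exists u : G, exists v : G, adj u v && (e == [set u; v])]].

Definition complete (G : sgraph) : bool :=
  [forall u : G, forall v : G, (u != v) ==> adj u v].

Definition complete_adj (n : nat) : rel 'I_n := fun u v => u != v.

Fact complete_adj_sym (n : nat) : symmetric (@complete_adj n).
Proof. by move=> u v; rewrite /complete_adj eq_sym. Qed.

Fact complete_adj_irrefl (n : nat) : irreflexive (@complete_adj n).
Proof. by move=> u; rewrite /complete_adj eqxx. Qed.

Definition complete_graph (n : nat) : sgraph :=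
  SGraph (@complete_adj_sym n) (@complete_adj_irrefl n).

Definition compl_adj (G : sgraph) : rel G := fun u v => (u != v) && ~~ adj u v.

Fact compl_adj_sym (G : sgraph) : symmetric (@compl_adj G).
Proof. by move=> u v; rewrite /compl_adj eq_sym adj_sym. Qed.

Fact compl_adj_irrefl (G : sgraph) : irreflexive (@compl_adj G).
Proof. by move=> u; rewrite /compl_adj eqxx. Qed.

Definition complement (G : sgraph) : sgraph :=
  SGraph (@compl_adj_sym G) (@compl_adj_irrefl G).

Definition add_edge_adj (G : sgraph) (e : {set G}) : rel G :=
  fun u v => adj u v || (u != v) && ([set u; v] == e).

Fact add_edge_adj_sym (G : sgraph) (e : {set G}) : symmetric (add_edge_adj e).
Proof. by move=> u v; rewrite /add_edge_adj adj_sym eq_sym setUC. Qed.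

Fact add_edge_adj_irrefl (G : sgraph) (e : {set G}) :
  irreflexive (add_edge_adj e).
Proof. by move=> u; rewrite /add_edge_adj adj_irrefl eqxx. Qed.

Definition add_edge (G : sgraph) (e : {set G}) : sgraph :=
  SGraph (add_edge_adj_sym e) (add_edge_adj_irrefl e).

(* The colours 1, ..., k are represented by the ordinals 0, ..., k - 1. *)
Definition edge_coloring (G : sgraph) (k : nat) : Type :=
  {e : {set G} | e \in edges G} -> 'I_k.

(* Copies are subgraphs, not necessarily induced. *)
Definition mono_copy (G : sgraph) (k : nat) (tau : edge_coloring G k)
    (i : 'I_k) (H : sgraph) : Prop :=
  exists f : H -> G, injective f /\
    forall u v : H, adj u v ->
      exists fuvE : [set f u; f v] \in edges G,
        tau (exist (fun e => e \in edges G) [set f u; f v] fuvE) = i.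

Definition arrows (G : sgraph) (k : nat) (H : 'I_k -> sgraph) : Prop :=
  forall tau : edge_coloring G k, exists i : 'I_k, mono_copy tau i (H i).

Definition co_critical (k : nat) (H : 'I_k -> sgraph) (G : sgraph) : Prop :=
  [/\ ~~ complete G,
      ~ arrows G H
    & forall e : {set G}, e \in edges (complement G) -> arrows (add_edge e) H].

Definition degree (G : sgraph) (v : G) : nat := #|[set u : G | adj v u]|.

(* As every degree is less than #|G|, the initial value #|G| does not affect
   the minimum, except that the empty graph gets the value 0. *)
Definition min_degree (G : sgraph) : nat :=
  \big[minn/#|G|]_(v : G) degree v.

(* Main.v *)
(* Let x be a vertex with a non-neighbour y.  In a critical colouring, the edges
   at x and those at y can be recoloured independently, and for every colour i
   the i-neighbourhoods of x and y share an i-coloured clique on t_i - 2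
   vertices.  Put m = t_l - 2 for the large colour l, and choose the colouring so
   that the l-neighbourhood S of x is as large as possible.  Then every other
   neighbour of x is l-adjacent to an m-clique of S.  If |S| < 2m, Hajnal's
   theorem yields a vertex w in all the m-cliques of S; then w is l-adjacent to
   all the j-neighbours of x, so xw can be recoloured with j, which leaves no
   m-clique in S.

   Hence deg x >= sum_i (t_i - 2) + m, and it remains to exclude equality.  In
   that case Hajnal's theorem, applied to S minus a, gives for every a in S a
   vertex b such that each m-clique of S meets {a, b}.  Moving vertices of S to
   the j-neighbourhood of x then shows that the non-neighbours of x are
   independent, so that any admissible colouring at x is also admissible at a
   non-neighbour y.  Two suitable colourings, one for x and one for y, finally
   have no common clique of the required size. *)
Require Import Defs.
From mathcomp Require Import all_boot all_order all_algebra.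
From mathcomp Require Import zify.

Set Implicit Arguments.
Unset Strict Implicit.
Unset Printing Implicit Defensive.

(** * Cliques and the core of the maximum cliques *)

Definition clique (T : finType) (r : rel T) (A : {set T}) : bool :=
  [forall u in A, forall v in A, (u != v) ==> r u v].

Lemma cliqueP (T : finType) (r : rel T) (A : {set T}) :
  reflect {in A &, forall u v, u != v -> r u v} (clique r A).
Proof.
apply: (iffP 'forall_in_forall_inP) => [H u v uA vA uv | H u uA v vA].
  by have := H u uA v vA; rewrite uv.
by apply/implyP; apply: H.
Qed.

Lemma clique_sub (T : finType) (r : rel T) (A B : {set T}) :
  A \subset B -> clique r B -> clique r A.
Proof.
move=> /subsetP sAB /cliqueP cB; apply/cliqueP => u v uA vA.
by apply: cB; apply: sAB.
Qed.

Lemma cliqueU1 (T : finType) (r : rel T) (x : T) (A : {set T}) :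
  symmetric r -> clique r A -> {in A, forall u, r x u} -> clique r (x |: A).
Proof.
move=> rC /cliqueP cA xA; apply/cliqueP => u v.
rewrite !inE => /predU1P[->|uA] /predU1P[->|vA]; rewrite ?eqxx // => uv.
- exact: xA.
- by rewrite rC; apply: xA.
- exact: cA.
Qed.

(* Hajnal: the intersection and the union of a nonempty family of maximum
   cliques have together at least [2 * m] vertices. *)
Lemma maximum_cliques_core (T : finType) (r : rel T) (S : {set T}) (m : nat) :
    symmetric r ->
    (forall A, clique r A -> A \subset S -> #|A| <= m) ->
    #|S| < m.*2 ->
    (exists2 A, clique r A & A \subset S /\ #|A| = m) ->
  exists2 w, w \in S &
    forall A, clique r A -> A \subset S -> #|A| = m -> w \in A.
Proof.
move=> rC maxm ltS [A0 cA0 [sA0 mA0]].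
pose F := [set A : {set T} | [&& clique r A, A \subset S & #|A| == m]].
(* Induct over the list of maximum cliques: [I] lies in all of them and is completely related to
   [U]. As [#|U| <= #|S| < m.*2], [I] is nonempty. *)
suff [I [U [sIF sIU sUS rIU le2m]]] : exists I U : {set T},
    [/\ (forall A, A \in enum F -> I \subset A), I \subset U, U \subset S,
        {in I & U, forall i u, i != u -> r i u} & m.*2 <= #|I| + #|U|].
  have /card_gt0P[w wI] : 0 < #|I| by have := subset_leq_card sUS; lia.
  exists w; first exact: (subsetP (subset_trans sIU sUS)).
  move=> A cA sA mA; apply: (subsetP (sIF A _)) => //.
  by rewrite mem_enum inE cA sA mA eqxx.
have : {subset enum F <= F} by move=> A; rewrite mem_enum.
elim: (enum F) => [|A l IHl] sF.
  by exists A0, A0; split=> //; [apply/cliqueP | rewrite mA0; lia].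
have [|I [U [sIl sIU sUS rIU le2m]]] := IHl.
  by move=> B Bl; apply: sF; rewrite inE Bl orbT.
have := sF A (mem_head _ _); rewrite inE => /and3P[cA sA /eqP mA].
exists (I :&: A), (U :|: A); split.
- move=> B; rewrite inE => /predU1P[->|Bl]; first exact: subsetIr.
  exact: subset_trans (subsetIl _ _) (sIl B Bl).
- exact: subset_trans (subset_trans (subsetIl _ _) sIU) (subsetUl _ _).
- by rewrite subUset sUS.
- move=> i u; rewrite !inE => /andP[iI iA] /orP[uU|uA]; first exact: rIU.
  exact: (cliqueP _ _ cA).
(* This clique has at most [m = #|A|] vertices, so passing to [I :&: A] and [U :|: A] does not lower
   the total size. *)
- have cK : clique r (I :|: (A :&: U)).
    apply/cliqueP => u v; rewrite !inE.
    move=> /orP[uI|/andP[uA uU]] /orP[vI|/andP[vA vU]] uv.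
    + by apply: rIU => //; apply: (subsetP sIU).
    + exact: rIU.
    + by rewrite rC; apply: rIU => //; rewrite eq_sym.
    + exact: (cliqueP _ _ cA).
  have := maxm _ cK; rewrite !subUset (subset_trans sIU sUS).
  rewrite (subset_trans (subsetIl _ _) sA) => /(_ isT).
  have := cardsUI I (A :&: U); have := cardsUI U A.
  have -> : I :&: (A :&: U) = I :&: A.
    by rewrite setIC -setIA (setIidPr sIU) setIC.
  rewrite (setIC A U); lia.
Qed.

Lemma set2_eq (T : finType) (u v a b : T) :
  [set u; v] = [set a; b] -> (u = a /\ v = b) \/ (u = b /\ v = a).
Proof.
move=> E.
have : u \in [set a; b] by rewrite -E set21.
have : v \in [set a; b] by rewrite -E set22.
have : a \in [set u; v] by rewrite E set21.
have : b \in [set u; v] by rewrite E set22.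
rewrite !inE.
by do 4![case/orP=> /eqP ?]; subst; auto.
Qed.

(** * Proper colourings and added edges *)

Section CoCritical.

Context {G : sgraph} {k : nat} (t : 'I_k -> nat).
Implicit Types (c : G -> G -> 'I_k) (f g : {ffun G -> 'I_k}) (i j : 'I_k).
Implicit Types (x y u v w z : G) (A B C : {set G}).

Definition color_rel c i : rel G := fun u v => adj u v && (c u v == i).

Definition proper c : Prop := forall i A, clique (color_rel c i) A -> #|A| < t i.

(** [f] is total, but only its values at neighbours of [x] count. *)
Definition color_nbrs x f i : {set G} := [set u | adj x u & f u == i].

(* Recolouring the edges [x u] with [f u] creates no forbidden clique. *)
Definition admissible c x f : bool :=
  [forall i, forall A : {set G},
    clique (color_rel c i) A && (A \subset color_nbrs x f i) ==> (#|A|.+1 < t i)].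

Lemma admissibleP c x f :
  reflect (forall i A, clique (color_rel c i) A -> A \subset color_nbrs x f i ->
             #|A|.+1 < t i)
          (admissible c x f).
Proof.
apply: (iffP 'forall_forallP) => [H i A cA sA|H i A].
  by have := H i A; rewrite cA sA.
by apply/implyP => /andP[]; apply: H.
Qed.

Lemma color_rel_sym c i : (forall u v, c u v = c v u) -> symmetric (color_rel c i).
Proof. by move=> cC u v; rewrite /color_rel adj_sym cC. Qed.

Definition set_coloring (i0 : 'I_k) c (e : {set G}) : 'I_k :=
  if [pick p : G * G | e == [set p.1; p.2]] is Some p then c p.1 p.2 else i0.

Lemma set_coloringE i0 c u v :
  (forall u v, c u v = c v u) -> set_coloring i0 c [set u; v] = c u v.
Proof.
move=> cC; rewrite /set_coloring; case: pickP => [[a b] /= /eqP E|/(_ (u, v))].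
  by case: (set2_eq E) => [[-> ->]|[-> ->]].
by rewrite eqxx.
Qed.

(** Maps from vertex sets to colours form a finite type, so the existence of a good one is
    decidable; if there is none, every [tau] contains a forbidden copy. *)
Lemma exists_proper_coloring :
    0 < k -> ~ arrows G (fun i => complete_graph (t i)) ->
  exists2 c, (forall u v, c u v = c v u) & proper c.
Proof.
move=> k0 nar.
case: (boolP [exists c : {ffun {set G} -> 'I_k}, forall i, forall A : {set G},
    clique (color_rel (fun u v => c [set u; v]) i) A ==> (#|A| < t i)]).
  move=> /existsP[c /'forall_forallP H]; exists (fun u v => c [set u; v]).
    by move=> u v; rewrite setUC.
  by move=> i A; apply/implyP.
move=> /existsPn H; exfalso; apply: nar => tau.
(* Non-edges get the default colour 0, which [color_rel] never sees. *)
pose c : {ffun {set G} -> 'I_k} := [ffun e =>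
  if (insub e : option {e : {set G} | e \in edges G}) is Some e' then tau e'
  else Ordinal k0].
have /forallPn[i /forallPn[A]] := H c.
rewrite negb_imply -leqNgt => /andP[/cliqueP cA leA].
exists i.
have lt_enum (u : 'I_(t i)) : u < #|A| by apply: leq_trans leA.
pose h (u : 'I_(t i)) := enum_val (Ordinal (lt_enum u)).
have inj_h : injective h by move=> u v /enum_val_inj [] /val_inj.
exists h; split=> // u v uv.
have := cA _ _ (enum_valP (Ordinal (lt_enum u))) (enum_valP (Ordinal (lt_enum v))).
rewrite -/(h u) -/(h v) (inj_eq inj_h) => /(_ uv) /andP[auv].
have huvE : [set h u; h v] \in edges G.
  rewrite inE; apply/existsP; exists (h u); apply/existsP; exists (h v).
  by rewrite auv eqxx.
by rewrite ffunE insubT => /eqP <-; exists huvE.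
Qed.

(** Give the new edge colour [i]. As [c] is proper, the monochromatic copy uses that edge, so it has
    colour [i]; delete [x] and [y] from it. *)
Lemma add_edge_clique c x y i :
    (forall u v, c u v = c v u) -> proper c -> x != y -> ~~ adj x y ->
    arrows (add_edge [set x; y]) (fun i => complete_graph (t i)) -> 1 < t i ->
  exists2 B, clique (color_rel c i) B &
    #|B| = t i - 2 /\ {in B, forall b, color_rel c i x b && color_rel c i y b}.
Proof.
move=> cC cP xy nxy arr t1.
pose tau (e : {e : {set add_edge [set x; y]} | e \in edges (add_edge [set x; y])}) :=
  if val e == [set x; y] then i else set_coloring i c (val e).
have [j [h [inj_h hE]]] := arr tau.
pose A : {set G} := [set h u | u : 'I_(t j)].
have cardA : #|A| = t j by rewrite card_imset // card_ord.
have relA : {in A &, forall u v, u != v ->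
    if [set u; v] == [set x; y] then i = j else color_rel c j u v}.
  move=> _ _ /imsetP[u _ ->] /imsetP[v _ ->]; rewrite (inj_eq inj_h) => uv.
  have [E] := hE u v uv; rewrite /tau /=; case: ifP => // nE.
  rewrite set_coloringE // /color_rel => ->; rewrite eqxx andbT.
  move: E; rewrite inE => /existsP[a /existsP[b /andP[ab /eqP E]]].
  have hab : a != b by apply: contraTneq ab => ->; rewrite adj_irrefl.
  move: ab => /=; rewrite /add_edge_adj /= -[[set a; b]]E nE andbF orbF => ab.
  by case: (set2_eq E) => [[-> ->]|[-> ->]] //; rewrite adj_sym.
have set2E u v : [set u; v] = [set x; y] -> (x \in [set u; v]) && (y \in [set u; v]).
  by move=> ->; rewrite !inE !eqxx orbT.
have /andP[xA yA] : (x \in A) && (y \in A).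
  apply/negPn/negP => nA; have := cP j A; rewrite cardA ltnn => /(_ _)/negP[] //.
  apply/cliqueP => u v uA vA uv; have := relA u v uA vA uv; case: eqP => // /set2E.
  rewrite !inE => /andP[xuv yuv]; case/negP: nA.
  by case/orP: xuv => /eqP ->; case/orP: yuv => /eqP ->; rewrite ?uA ?vA.
have := relA x y xA yA xy; rewrite eqxx => ij; subst j.
have relB u v : u \in A -> v \in A :\ x :\ y -> u != v -> color_rel c i u v.
  move=> uA; rewrite !inE => /and3P[vy vx vA] uv.
  have := relA u v uA vA uv; case: eqP => // /set2E.
  rewrite !inE [x == v]eq_sym [y == v]eq_sym (negPf vx) (negPf vy) !orbF.
  by move=> /andP[/eqP xu /eqP yu]; rewrite xu yu eqxx in xy.
exists (A :\ x :\ y).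
  apply/cliqueP => u v uA; apply: relB.
  by move: uA; rewrite !inE => /and3P[].
split.
  have := cardsD1 x A; have := cardsD1 y (A :\ x).
  rewrite xA !inE eq_sym xy yA cardA /=; lia.
move=> b bB; move: (bB); rewrite !inE => /and3P[bY bX bA].
by rewrite !relB // eq_sym.
Qed.

(** * Recolouring the edges at a vertex *)

Lemma color_nbrs_adj x f i u : u \in color_nbrs x f i -> adj x u.
Proof. by rewrite inE => /andP[]. Qed.

Lemma color_nbrs_irrefl x f i : x \notin color_nbrs x f i.
Proof. by rewrite inE adj_irrefl. Qed.

Lemma admissible_self c x :
  (forall u v, c u v = c v u) -> proper c -> admissible c x (finfun (c x)).
Proof.
move=> cC cP; apply/admissibleP => i A cA /subsetP sA.
have xA : x \notin A by apply/negP => /sA; rewrite (negPf (color_nbrs_irrefl _ _ _)).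
have := cP i (x |: A); rewrite cardsU1 xA; apply; apply: cliqueU1 cA _.
  exact: color_rel_sym.
by move=> u /sA; rewrite inE ffunE.
Qed.

Definition recolor c x f u v : 'I_k :=
  if u == x then f v else if v == x then f u else c u v.

Lemma recolor_sym c x f :
  (forall u v, c u v = c v u) -> forall u v, recolor c x f u v = recolor c x f v u.
Proof.
by move=> cC u v; rewrite /recolor; case: eqP => [->|]; case: eqP => [e|]; rewrite ?e.
Qed.

Lemma clique_recolor c x f i A :
  x \notin A -> clique (color_rel (recolor c x f) i) A = clique (color_rel c i) A.
Proof.
move=> xA; apply: eq_forallb_in => u uA; apply: eq_forallb_in => v vA.
have ux : u != x by apply: contraNneq xA => <-.
have vx : v != x by apply: contraNneq xA => <-.
by rewrite /color_rel /recolor (negPf ux) (negPf vx).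
Qed.

Lemma recolor_proper c x f :
  proper c -> admissible c x f -> proper (recolor c x f).
Proof.
move=> cP /admissibleP fP i A cA; have [xA|xA] := boolP (x \in A); last first.
  by apply: cP; rewrite clique_recolor in cA.
rewrite (cardsD1 x) xA; apply: fP.
  rewrite -(@clique_recolor c x f); last by rewrite !inE eqxx.
  by apply: clique_sub cA; apply: subD1set.
apply/subsetP => u; rewrite !inE => /andP[ux uA].
have := cliqueP _ _ cA x u xA uA; rewrite eq_sym => /(_ ux).
by rewrite /color_rel /recolor eqxx.
Qed.

(** No clique among the neighbours of [y] contains [x]. *)
Lemma recolor_admissible c x f y g :
  ~~ adj x y -> admissible c y g -> admissible (recolor c x f) y g.
Proof.
move=> nxy /admissibleP gP; apply/admissibleP => i A cA sA.
apply: gP => //; rewrite clique_recolor in cA => //.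
apply: contra nxy => xA; rewrite adj_sym.
by have := subsetP sA x xA => /color_nbrs_adj.
Qed.

(** Recolour at [x] by [f] and at [y] by [g], then add the edge. *)
Lemma crossing_clique c x y f g i :
    (forall u v, c u v = c v u) -> proper c -> x != y -> ~~ adj x y ->
    arrows (add_edge [set x; y]) (fun i => complete_graph (t i)) -> 1 < t i ->
    admissible c x f -> admissible c y g ->
  exists B, [/\ clique (color_rel c i) B, #|B| = t i - 2,
    B \subset color_nbrs x f i & B \subset color_nbrs y g i].
Proof.
move=> cC cP xy nxy arr t1 fP gP.
have [B cB [cardB BE]] := add_edge_clique
  (recolor_sym y g (recolor_sym x f cC))
  (recolor_proper (recolor_proper cP fP) (recolor_admissible f nxy gP)) xy nxy arr t1.
have Badj b : b \in B -> adj x b && adj y b.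
  by move=> /BE /andP[/andP[-> _] /andP[-> _]].
have xB : x \notin B by apply/negP => /Badj; rewrite adj_irrefl.
have yB : y \notin B by apply/negP => /Badj; rewrite adj_irrefl andbF.
rewrite !clique_recolor // in cB; exists B; split=> //; apply/subsetP => b bB.
- have by_ : b != y by apply: contraNneq yB => <-.
  have /andP[+ _] := BE b bB.
  by rewrite inE /color_rel /recolor (negPf xy) (negPf by_) eqxx.
- have /andP[_ +] := BE b bB.
  by rewrite inE /color_rel /recolor eqxx.
Qed.

Definition move_vertex f v i : {ffun G -> 'I_k} :=
  [ffun u => if u == v then i else f u].

Lemma color_nbrs_move x f v i j :
  color_nbrs x (move_vertex f v i) j =
  if j == i then if adj x v then v |: color_nbrs x f j else color_nbrs x f j
  else color_nbrs x f j :\ v.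
Proof.
apply/setP => u; case: eqP => [->|/eqP ji].
  case: ifP => av; rewrite !inE ffunE; case: (eqVneq u v) => //= ->.
    by rewrite av eqxx.
  by rewrite av.
by rewrite !inE ffunE; case: (eqVneq u v) => //= _; rewrite eq_sym (negPf ji) andbF.
Qed.

(** Only cliques of colour [i] through [v] are new. *)
Lemma admissible_move c x f v i :
    admissible c x f ->
    (forall A, clique (color_rel c i) A -> v \in A ->
       A \subset v |: color_nbrs x f i -> #|A|.+1 < t i) ->
  admissible c x (move_vertex f v i).
Proof.
move=> /admissibleP fP vP; apply/admissibleP => j A cA.
rewrite color_nbrs_move; case: eqP => [ji|_]; last first.
  by move=> sA; apply: fP cA (subset_trans sA (subsetDl _ _)).
subst j; case: ifP => _; last exact: fP.
have [vA|vA] := boolP (v \in A); first exact: vP.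
move=> sA; apply: fP cA _; apply/subsetP => u uA.
have := subsetP sA u uA; rewrite !inE => /predU1P[uv|//].
by rewrite -uv uA in vA.
Qed.

(** * A colouring at [x] with the largest possible [l]-class *)

Section MaximalColorClass.

Context (c : G -> G -> 'I_k) (x : G) (f : {ffun G -> 'I_k}) (j l : 'I_k).
Hypotheses (cC : forall u v, c u v = c v u) (cP : proper c).
Hypothesis crit : forall u v, u != v -> ~~ adj u v ->
  arrows (add_edge [set u; v]) (fun i => complete_graph (t i)).
Hypotheses (t3 : forall i, 2 < t i) (jl : j != l) (fP : admissible c x f).
Hypothesis fmax : forall g, admissible c x g ->
  #|color_nbrs x g l| <= #|color_nbrs x f l|.

Notation N := (color_nbrs x f).
Notation rel_ := (color_rel c).

Lemma nbr_crossing_clique y g h i :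
    x != y -> ~~ adj x y -> admissible c x g -> admissible c y h ->
  exists B, [/\ clique (rel_ i) B, #|B| = t i - 2,
    B \subset color_nbrs x g i & B \subset color_nbrs y h i].
Proof.
move=> xy nxy gP hP; apply: crossing_clique => //; first exact: crit.
exact: ltnW.
Qed.

Lemma clique_card_le A : clique (rel_ l) A -> A \subset N l -> #|A| <= t l - 2.
Proof.
by move=> cA sA; have := admissibleP _ _ _ fP l A cA sA; have := t3 l; clear; lia.
Qed.

(** By [fmax], moving [v] into the [l]-class is not admissible; the obstructing clique without [v]
    is the one sought. *)
Lemma linked_clique v i :
    v \in N i -> i != l ->
  exists B, [/\ clique (rel_ l) B, #|B| = t l - 2, B \subset N l
    & {in B, forall b, rel_ l v b}].
Proof.
move=> vN il; have xv := color_nbrs_adj vN.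
have vl : v \notin N l.
  by move: vN; rewrite !inE => /andP[_ /eqP ->]; rewrite negb_and il orbT.
have : ~~ admissible c x (move_vertex f v l).
  apply/negP => /fmax; rewrite color_nbrs_move eqxx xv cardsU1 vl; lia.
move=> /negP nadm; suff /existsP[A /and4P[cA vA sA ltA]] :
    [exists A : {set G}, [&& clique (rel_ l) A, v \in A, A \subset v |: N l
       & t l <= #|A|.+1]].
  have sD : A :\ v \subset N l.
    apply/subsetP => u; rewrite in_setD1 => /andP[uv /(subsetP sA)].
    by rewrite in_setU1 (negPf uv).
  have cD : clique (rel_ l) (A :\ v) by apply: clique_sub cA; apply: subD1set.
  exists (A :\ v); split=> //.
    have := clique_card_le cD sD.
    by have := cardsD1 v A; rewrite vA; have := t3 l; lia.
  move=> b; rewrite !inE => /andP[bv bA]; apply: (cliqueP _ _ cA) => //.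
  by rewrite eq_sym.
apply: contraT => /existsPn H; case: nadm; apply: admissible_move => // A cA vA sA.
by have := H A; rewrite cA vA sA /= -ltnNge.
Qed.

Lemma color_rel_unique i i' u v : rel_ i u v -> rel_ i' u v -> i = i'.
Proof. by move=> /andP[_ /eqP <-] /andP[_ /eqP <-]. Qed.

Lemma card_max_class y :
  x != y -> ~~ adj x y -> (t l - 2).*2 <= #|N l|.
Proof.
move=> xy nxy; rewrite leqNgt; apply/negP => ltS.
have crossf g gP := @nbr_crossing_clique y g _ l xy nxy gP (admissible_self y cC cP).
have [||w wS wcore] := maximum_cliques_core (color_rel_sym l cC) _ ltS.
- exact: clique_card_le.
- by have [B [cB cardB sB _]] := crossf _ fP; exists B.
(* Each [v] in [N j] has a linked clique, which contains [w]; so [v w] has colour [l], and a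
   [j]-clique through [w] inside [w |: N j] is just [w]. *)
have adm : admissible c x (move_vertex f w j).
  apply: admissible_move => // A cA wA sA.
  suff /subset_leq_card : A \subset [set w] by rewrite cards1; have := t3 j; lia.
  apply/subsetP => v vA; rewrite inE; apply/negPn/negP => vw.
  have vN : v \in N j by have := subsetP sA v vA; rewrite !inE (negPf vw).
  have [B [cB cardB sB Bv]] := linked_clique vN jl.
  have /(color_rel_unique (Bv w (wcore B cB sB cardB))) E := cliqueP _ _ cA v w vA wA vw.
  by move: jl; rewrite E eqxx.
have [B [cB cardB sB _]] := crossf _ adm.
rewrite color_nbrs_move eq_sym (negPf jl) in sB.
have := wcore B cB (subset_trans sB (subsetDl _ _)) cardB.
by move=> /(subsetP sB); rewrite !inE eqxx.
Qed.

(** * The extremal case, with all colour classes of least size *)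

Section Extremal.

Hypothesis cardN : forall i, i != l -> #|N i| = t i - 2.
Hypothesis cardNl : #|N l| = (t l - 2).*2.
Context (y0 : G).
Hypotheses (xy0 : x != y0) (nxy0 : ~~ adj x y0).

Definition hits a b := forall A,
  clique (rel_ l) A -> A \subset N l -> #|A| = t l - 2 -> (a \in A) || (b \in A).

(** [N l :\ a] has fewer than [2 * (t l - 2)] vertices, so its maximum cliques of size [t l - 2]
    share a vertex [b]; if there are none, [b = a] works. *)
Lemma exists_hits a : a \in N l -> exists2 b, b \in N l & hits a b.
Proof.
move=> aS.
case: (boolP [exists A : {set G}, [&& clique (rel_ l) A, A \subset N l :\ a
    & #|A| == t l - 2]]) => [/existsP[A0 /and3P[cA0 sA0 /eqP cardA0]]|/existsPn nA].
  have [|||b bS bcore] := @maximum_cliques_core _ _ (N l :\ a) (t l - 2) (color_rel_sym l cC).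
  - by move=> A cA sA; apply: clique_card_le => //; apply: subset_trans sA (subsetDl _ _).
  - by have := cardsD1 a (N l); rewrite aS cardNl; have := t3 l; lia.
  - by exists A0.
  exists b; first by move: bS; rewrite in_setD1 => /andP[].
  move=> A cA sA cardA; case: (boolP (a \in A)) => //= aA.
  by apply: bcore => //; rewrite subsetD1 sA.
exists a => // A cA sA cardA; rewrite orbb; apply/negPn/negP => aA.
by have := nA A; rewrite cA cardA eqxx subsetD1 sA aA.
Qed.

Lemma color_class_common i y h :
    i != l -> x != y -> ~~ adj x y -> admissible c y h ->
  clique (rel_ i) (N i) /\ N i \subset color_nbrs y h i.
Proof.
move=> il xy nxy hP.
have [B [cB cardB sB sB']] := nbr_crossing_clique i xy nxy fP hP.
suff E : B = N i by rewrite -E.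
by apply/eqP; rewrite eqEcard sB cardB cardN /=.
Qed.

Definition joined z := [forall v in N j, rel_ j z v].

(** A [j]-clique through [w] cannot be all of [w |: N j], so it has at most [t j - 2] vertices. *)
Lemma admissible_unjoined w :
  w \in N l -> ~~ joined w -> admissible c x (move_vertex f w j).
Proof.
move=> wS; rewrite /joined negb_forall_in => /exists_inP[v vN nwv].
apply: admissible_move => // A cA wA sA.
have wv : w != v.
  by apply: contraNneq jl => E; move: vN wS; rewrite E !inE => /andP[_ /eqP <-] /andP[_].
suff : #|A| < #|w |: N j|.
  by rewrite cardsU1 cardN //; have := t3 j; case: (w \notin _); lia.
apply: proper_card; rewrite properE sA; apply: contra nwv => /subsetP sNA.
by apply: (cliqueP _ _ cA) => //; apply: sNA; rewrite in_setU1 vN orbT.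
Qed.

Lemma unjoined_cross y a :
    x != y -> ~~ adj x y -> a \in N l -> ~~ joined a ->
  exists C, [/\ clique (rel_ l) C, #|C| = t l - 2, C \subset N l, a \notin C
    & {in C, forall b, rel_ l y b}].
Proof.
move=> xy nxy aS /admissible_unjoined -/(_ aS) adm.
have [C [cC' cardC]] := nbr_crossing_clique l xy nxy adm (admissible_self y cC cP).
rewrite color_nbrs_move eq_sym (negPf jl) subsetD1 => /andP[sC aC] sC'.
exists C; split=> // b /(subsetP sC'); by rewrite inE ffunE.
Qed.

Lemma exists_Nj : exists v, v \in N j.
Proof. by apply/card_gt0P; rewrite cardN //; have := t3 j; lia. Qed.

(* The maximum cliques of [N l] that are [l]-adjacent to [v] miss [z], as [v z]
   has colour [j]; hence they contain [b], and none is left once [b] moves out. *)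
Lemma exchange z b v :
    z \in N l -> b \in N l -> v \in N j -> joined z -> hits z b ->
  ~~ joined b /\ admissible c x (move_vertex (move_vertex f b j) v l).
Proof.
move=> zS bS vN /forall_inP zJ hzb.
have nlz : ~~ rel_ l v z.
  apply: contraNN jl => vz; have := zJ v vN; rewrite color_rel_sym //.
  by move=> /(color_rel_unique vz) ->.
have nbJ : ~~ joined b.
  have [B [cB cardB sB Bv]] := linked_clique vN jl.
  case/orP: (hzb B cB sB cardB) => [/Bv|/Bv vb]; first by rewrite (negPf nlz).
  apply: contraNN jl => /forall_inP /(_ v vN); rewrite color_rel_sym //.
  by move=> /(color_rel_unique vb) ->.
split=> //; apply: admissible_move; first exact: admissible_unjoined.
move=> A cA vA; rewrite color_nbrs_move eq_sym (negPf jl) => sA.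
have sD : A :\ v \subset N l :\ b.
  apply/subsetP => u; rewrite in_setD1 => /andP[uv /(subsetP sA)].
  by rewrite in_setU1 (negPf uv).
have sD' := subset_trans sD (subsetDl _ _).
have cD : clique (rel_ l) (A :\ v) by apply: clique_sub cA; apply: subD1set.
have := cardsD1 v A; have := clique_card_le cD sD'; rewrite vA.
have := t3 l; case: (#|A :\ v| =P t l - 2) => [cardD|]; last by clear; lia.
case/orP: (hzb _ cD sD' cardD) => [|/(subsetP sD)]; last by rewrite !inE eqxx.
rewrite in_setD1 => /andP[zv zA].
by move: nlz; rewrite (cliqueP _ _ cA) // eq_sym.
Qed.

Lemma color_nbrs_exchange b v :
    b \in N l ->
  color_nbrs x (move_vertex (move_vertex f b j) v l) j = (b |: N j) :\ v.
Proof.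
by move=> /color_nbrs_adj xb; rewrite !color_nbrs_move eqxx (negPf jl) xb.
Qed.

Lemma color_nbrs_disjoint u i i' : u \in N i -> u \in N i' -> i = i'.
Proof. by rewrite !inE => /andP[_ /eqP <-] /andP[_ /eqP]. Qed.

(** The exchanged [j]-class again has only [t j - 2] vertices, so the crossing clique with [y] is
    all of it, including [b]. *)
Lemma exchanged_color z b y :
    x != y -> ~~ adj x y -> z \in N l -> b \in N l -> joined z -> hits z b ->
  rel_ j y b.
Proof.
move=> xy nxy zS bS zJ hzb; have [v vN] := exists_Nj.
have [_ adm] := exchange zS bS vN zJ hzb.
have [B [_ cardB sB]] := nbr_crossing_clique j xy nxy adm (admissible_self y cC cP).
have bN : b \notin N j.
  by apply: contraNN jl => /(color_nbrs_disjoint bS) ->.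
rewrite color_nbrs_exchange // in sB.
suff -> : B = (b |: N j) :\ v.
  move=> /subsetP /(_ b); rewrite !inE ffunE eqxx; apply; rewrite andbT.
  by apply: contraNneq bN => ->.
apply/eqP; rewrite eqEcard sB cardB.
have := cardsD1 v (b |: N j); rewrite cardsU1 bN in_setU1 vN orbT cardN //; clear; lia.
Qed.

(** An edge [y y'] of colour [i], with a common [i]-clique of size [t i - 2], would give a forbidden
    clique. *)
Lemma nonnbrs_independent y y' :
  x != y -> ~~ adj x y -> x != y' -> ~~ adj x y' -> ~~ adj y y'.
Proof.
move=> xy nxy xy' nxy'; apply/negP => ayy'.
have yy' : y != y' by apply: contraTneq ayy' => ->; rewrite adj_irrefl.
suff [i [C [cC' cardC Cy Cy']]] : exists i C, [/\ clique (rel_ i) C, #|C| = t i - 2,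
    {in C, forall b, rel_ i y b}, {in C, forall b, rel_ i y' b} & c y y' = i].
  move=> cyy'; have yC : y \notin y' |: C.
    rewrite !inE negb_or yy'; apply/negP => /Cy.
    by rewrite /color_rel adj_irrefl.
  have y'C : y' \notin C by apply/negP => /Cy'; rewrite /color_rel adj_irrefl.
  have := cP (i := i) (A := y |: (y' |: C)).
  rewrite !cardsU1 yC y'C cardC; have := t3 i => ti /(_ _).
  suff -> : clique (rel_ i) (y |: (y' |: C)) by move=> /(_ isT); move: ti; clear; lia.
  apply: cliqueU1; [exact: color_rel_sym| |].
    by apply: cliqueU1 => //; exact: color_rel_sym.
  by move=> u; rewrite !inE => /predU1P[->|/Cy //]; rewrite /color_rel ayy' cyy' eqxx.
have selfP y := admissible_self y cC cP.
have [E|cl] := eqVneq (c y y') l; last first.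
  (* For a colour other than [l], the whole class at [x] serves as [C]. *)
  have [cN sN] := color_class_common cl xy nxy (selfP y).
  have [_ sN'] := color_class_common cl xy' nxy' (selfP y').
  exists (c y y'), (N (c y y')); split=> //; first exact: cardN.
    by move=> b /(subsetP sN); rewrite inE ffunE.
  by move=> b /(subsetP sN'); rewrite inE ffunE.
have [C [cC' cardC sC sC']] := nbr_crossing_clique l xy nxy fP (selfP y).
have Cy : {in C, forall b, rel_ l y b}.
  by move=> b /(subsetP sC'); rewrite inE ffunE.
exists l, C; split=> // b bC.
(* If the partner [a] of [b] is joined, [y b] would have colour [j], not [l]. Otherwise [a] can be
   moved away, and the resulting clique at [y'] must contain [b]. *)
have bS := subsetP sC b bC; have [a aS hba] := exists_hits bS.
have [aJ|aJ] := boolP (joined a).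
  have hab : hits a b by move=> A cA sA cardA; rewrite orbC; apply: hba.
  have := exchanged_color xy nxy aS bS aJ hab => /(color_rel_unique (Cy b bC)) lj.
  by move: jl; rewrite lj eqxx.
have [D [cD cardD sD aD Dy']] := unjoined_cross xy' nxy' aS aJ.
by apply: Dy'; have := hba D cD sD cardD; rewrite (negPf aD) orbF.
Qed.

(** By independence, every neighbour of [y] is a neighbour of [x]. *)
Lemma admissible_nonnbr y g :
  x != y -> ~~ adj x y -> admissible c x g -> admissible c y g.
Proof.
move=> xy nxy /admissibleP gP; apply/admissibleP => i A cA sA; apply: gP => //.
apply: subset_trans sA _; apply/subsetP => u; rewrite !inE => /andP[yu ->].
rewrite andbT; apply: contraTT yu => nxu; have [<-|xu] := eqVneq x u.
  by rewrite adj_sym.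
exact: nonnbrs_independent.
Qed.

Lemma extremal_contradiction : False.
Proof.
have cross g h i gP (hP : admissible c x h) :=
  @nbr_crossing_clique y0 g h i xy0 nxy0 gP (admissible_nonnbr xy0 nxy0 hP).
have [v vN] := exists_Nj.
case: (boolP [exists z in N l, joined z]) => [/exists_inP[z zS zJ]|/exists_inPn nJ].
  (* Use [f] at [x] and the exchanged colouring at [y0]: a common [j]-clique avoids [v], leaving
     only [t j - 3] vertices. *)
  have [b bS hzb] := exists_hits zS; have [_ adm] := exchange zS bS vN zJ hzb.
  have [B [_ cardB sB]] := cross _ _ j fP adm.
  move=> /subsetP sB'; have : #|B| <= #|N j :\ v|.
    apply: subset_leq_card; apply/subsetP => u uB.
    rewrite in_setD1 (subsetP sB) // andbT; apply: contraTneq (sB' u uB) => ->.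
    by rewrite !inE ffunE eqxx eq_sym (negPf jl) andbF.
  have := cardsD1 v (N j); rewrite vN cardN // cardB; have := t3 j; clear; lia.
have /card_gt0P[a aS] : 0 < #|N l| by rewrite cardNl; have := t3 l; lia.
(* Move [a] away at [x] and [b] away at [y0]: the common [l]-clique misses both. *)
have [b bS hab] := exists_hits aS.
have [C [cC' cardC]] := cross _ _ l (admissible_unjoined aS (nJ a aS))
  (admissible_unjoined bS (nJ b bS)).
rewrite color_nbrs_move eq_sym (negPf jl) subsetD1 => /andP[sC aC] /subsetP sC'.
have := hab C cC' sC cardC; rewrite (negPf aC) => /sC'.
by rewrite !inE ffunE eqxx (negPf jl) andbF.
Qed.

End Extremal.

End MaximalColorClass.

(** * From colour classes to the minimum degree *)

Lemma degree_color_nbrs x f : degree x = \sum_i #|color_nbrs x f i|.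
Proof.
rewrite /degree -sum1dep_card (partition_big f xpredT) //=.
by apply: eq_bigr => i _; rewrite -sum1dep_card.
Qed.

Lemma degree_lower_bound x y j l :
    co_critical (fun i => complete_graph (t i)) G -> (forall i, 2 < t i) ->
    j != l -> x != y -> ~~ adj x y ->
  \sum_i (t i - 2) + (t l - 1) <= degree x.
Proof.
move=> [_ nar arr] t3 jl xy nxy.
have [c cC cP] := exists_proper_coloring (leq_ltn_trans (leq0n j) (ltn_ord j)) nar.
have crit u v : u != v -> ~~ adj u v ->
    arrows (add_edge [set u; v]) (fun i => complete_graph (t i)).
  move=> uv nuv; apply: arr; rewrite inE; apply/existsP; exists u.
  by apply/existsP; exists v; rewrite /= /compl_adj uv nuv eqxx.
case: (@arg_maxnP _ _ (admissible c x) (fun f => #|color_nbrs x f l|)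
  (admissible_self x cC cP)) => f fP fmax.
rewrite leqNgt; apply/negP => ltd.
pose low i := (t i - 2) + (if i == l then t l - 2 else 0).
have le_low i : low i <= #|color_nbrs x f i|.
  rewrite /low; case: eqVneq => [->|il].
    by rewrite addnn; apply: (card_max_class cC cP crit t3 jl fP fmax xy nxy).
  have [B [_ cardB sB _]] :=
    nbr_crossing_clique cC cP crit t3 i xy nxy fP (admissible_self y cC cP).
  by rewrite addn0 -cardB subset_leq_card.
have le_sum : \sum_i #|color_nbrs x f i| <= \sum_i low i.
  rewrite -degree_color_nbrs big_split /= -big_mkcond big_pred1_eq.
  rewrite -ltnS; apply: leq_trans ltd _.
  by rewrite -addnS leq_add2l; have := t3 l; clear; lia.
(* Equality of the sums forces equality in each class, which is the extremal case. *)
have : \sum_i low i == \sum_i #|color_nbrs x f i|.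
  by rewrite eqn_leq le_sum andbT; apply: leq_sum.
have [_ ->] := @leqif_sum _ xpredT _ _ _ (fun i _ => leqif_eq (le_low i)).
move=> /forallP /= eq_low.
apply: (extremal_contradiction cC cP crit t3 jl fP fmax _ _ xy nxy).
  by move=> i il; have /eqP <- := eq_low i; rewrite /low (negPf il) addn0.
by have /eqP <- := eq_low l; rewrite /low eqxx addnn.
Qed.

End CoCritical.

(** Covers vertices without non-neighbours, which [degree_lower_bound] does not reach. *)
Lemma degree_universal (G : sgraph) (x v : G) :
  (forall y, v != y -> adj v y) -> degree x <= degree v.
Proof.
move=> vU; apply: (@leq_trans #|G|.-1).
  rewrite -(cardsC1 x); apply: subset_leq_card; apply/subsetP => u.
  by rewrite !inE; apply: contraTneq => ->; rewrite adj_irrefl.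
rewrite -(cardsC1 v); apply: subset_leq_card; apply/subsetP => u.
by rewrite !inE eq_sym; apply: vU.
Qed.

Theorem theorem1p8 (k : nat) (t : nat -> nat) (hk : (2 <= k)%N)
    (ht1 : (3 <= t 1%N)%N)
    (ht : forall i : nat, (1 <= i < k)%N -> (t i <= t i.+1)%N)
    (G : sgraph)
    (hG : co_critical (fun i : 'I_k => complete_graph (t i.+1)) G) :
  ((t k)%:Z - 2%:Z * k%:Z - 1 + \sum_(1 <= i < k.+1) (t i)%:Z
     <= (min_degree G)%:Z)%R.
Proof.
have t3 n : n < k -> 2 < t n.+1.
  elim: n => [//|n IHn] nk; apply: leq_trans (IHn (ltnW nk)) (ht _ _); lia.
have k0 : 0 < k by apply: ltnW.
have lk : k.-1 < k by rewrite prednK.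
(* [l] is the last colour, with clique size [t k]; [j] differs from it since [k >= 2]. *)
pose j := Ordinal k0; pose l := Ordinal lk.
have jl : j != l by rewrite -val_eqE /=; lia.
have bound x y : x != y -> ~~ adj x y ->
    \sum_(i < k) (t i.+1 - 2) + (t k - 1) <= @degree G x.
  have := @degree_lower_bound G k (fun i => t i.+1) x y j l hG.
  by rewrite /= prednK //; apply=> // i; apply: t3.
have [/forallPn[x /forallPn[y nxy_imp]] _ _] := hG.
move: nxy_imp; rewrite negb_imply => /andP[xy nxy].
have le_min : \sum_(i < k) (t i.+1 - 2) + (t k - 1) <= min_degree G.
  apply: (big_ind (fun m => _ <= m)) => [|m n|v _].
  - exact: leq_trans (bound x y xy nxy) (max_card _).
  - by move=> ltm ltn; rewrite leq_min ltm.
  have [/existsP[u /andP[vu nvu]]|/existsPn vU] :=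
    boolP [exists u, (v != u) && ~~ adj v u]; first exact: bound vu nvu.
  apply: leq_trans (bound x y xy nxy) _; apply: degree_universal => u vu.
  by have := vU u; rewrite vu negbK.
(* The truncated subtractions are exact because every [t i.+1] is at least 3. *)
have sumE : \sum_(i < k) t i.+1 = \sum_(i < k) (t i.+1 - 2) + k * 2.
  have -> : k * 2 = \sum_(i < k) 2 by rewrite sum_nat_const card_ord.
  rewrite -big_split /=.
  by apply: eq_bigr => i _; rewrite subnK // ltnW // t3.
rewrite big_add1 big_mkord /= -(big_morph Posz PoszD (erefl _)) sumE.
have := t3 _ lk; rewrite prednK //; move: le_min; clear; lia.
Qed.
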